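(* Let $(M,\omega)$ be a closed connected $2$-dimensional symplectic manifold. There exists a constant $C=C(M,\omega)>0$ such that for every pair of smooth functions $F,G$ on $M$ and every $s\ge 0$ $$\rho_{F,G}(s)\ge\rho_{F,G}(0)-C\sqrt s.$$ In particular, $\rho_{F,G}$ is continuous at $0$.
   Context: For smooth functions on $M$ let $\|F\|=\max_M|F|$, let the Hamiltonian vector field be given by $i_{\mathrm{sgrad}F}\,\omega=-dF$ and $\{F,G\}=\omega(\mathrm{sgrad}\,G,\mathrm{sgrad}\,F)$. On $\mathcal F=C^\infty(M)\times C^\infty(M)$ use the distance $d((F,G),(H,K))=\|F-H\|+\|G-K\|$. For $s\ge 0$ let $\mathcal K_s=\{(H,K)\in\mathcal F:\|\{H,K\}\|\le s\}$. The profile function of $(F,G)$ is $\rho_{F,G}(s)=\inf_{(H,K)\in\mathcal K_s}d((F,G),(H,K))$ for $s\ge0$. *)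

(* Defs.v *)
From mathcomp Require Import all_boot all_order all_algebra.
From mathcomp Require Import all_classical all_reals all_analysis.

Set Implicit Arguments.
Unset Strict Implicit.
Unset Printing Implicit Defensive.

Import Order.TTheory GRing.Theory Num.Theory.
Import numFieldNormedType.Exports.

Local Open Scope classical_set_scope.
Local Open Scope ring_scope.

Section smooth_maps.
Context {R : realType} {n : nat} {V : normedModType R}.

Definition iter_partial (s : seq 'I_n) (f : 'rV[R]_n -> V) :
    'rV[R]_n -> V :=
  foldr (fun i g x => 'D_(delta_mx 0 i) g x) f s.

(* C^oo on an open set U: every iterated partial derivative is (Frechet)
   differentiable, hence continuous, at every point of U. *)
Definition smooth_on (U : set 'rV[R]_n) (f : 'rV[R]_n -> V) : Prop :=
  forall s x, U x -> differentiable (iter_partial s f) x.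

End smooth_maps.

(* [chart_map] and [chart_inv] are mutually inverse homeomorphisms between
   the open sets [chart_dom] and [chart_cod]; their values outside these sets
   are irrelevant. *)
Record chart (R : realType) (n : nat) (M : topologicalType) := Chart {
  chart_dom : set M ;
  chart_cod : set 'rV[R]_n ;
  chart_map :> M -> 'rV[R]_n ;
  chart_inv : 'rV[R]_n -> M ;
  chart_dom_open : open chart_dom ;
  chart_cod_open : open chart_cod ;
  chart_map_cod : set_fun chart_dom chart_cod chart_map ;
  chart_inv_dom : set_fun chart_cod chart_dom chart_inv ;
  chart_mapK : {in chart_dom, cancel chart_map chart_inv} ;
  chart_invK : {in chart_cod, cancel chart_inv chart_map} ;
  chart_map_continuous : {within chart_dom, continuous chart_map} ;
  chart_inv_continuous : {within chart_cod, continuous chart_inv} }.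

(* A smooth manifold without boundary of dimension n.  The atlas need not
   be maximal.  The preferred chart [chart_at p] around p serves to represent
   the tangent space at p, see [differential] and [chart_vector]. *)
Record smooth_manifold (R : realType) (n : nat) (M : topologicalType) :=
  SmoothManifold {
  atlas : set (chart R n M) ;
  chart_at : M -> chart R n M ;
  chart_at_atlas : forall p, atlas (chart_at p) ;
  chart_at_dom : forall p, chart_dom (chart_at p) p ;
  transition_smooth : forall a b, atlas a -> atlas b ->
    smooth_on (a @` (chart_dom a `&` chart_dom b)) (b \o chart_inv a) ;
  manifold_hausdorff : hausdorff_space M ;
  manifold_second_countable : @second_countable M }.

Section manifold.
Context {R : realType} {n : nat} {M : topologicalType}.
Variable X : smooth_manifold R n M.

Definition smooth (F : M -> R) : Prop :=
  forall a, atlas X a -> smooth_on (chart_cod a) (F \o chart_inv a).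

(* A tangent vector at p is given by its components in [chart_at X p]. *)
Local Notation tangent := 'rV[R]_n.

Definition differential (F : M -> R) (p : M) (v : tangent) : R :=
  'D_v (F \o chart_inv (chart_at X p)) (chart_at X p p).

(* The tangent vector at [chart_inv a x] whose components in the chart a are
   those of u. *)
Definition chart_vector (a : chart R n M) (x u : 'rV[R]_n) : tangent :=
  'D_u (chart_at X (chart_inv a x) \o chart_inv a) x.

(* The component omega_ij, in the chart a, of a field omega of bilinear forms
   on the tangent spaces. *)
Definition form_coord (omega : M -> tangent -> tangent -> R)
    (a : chart R n M) (i j : 'I_n) (x : 'rV[R]_n) : R :=
  omega (chart_inv a x) (chart_vector a x (delta_mx 0 i))
                        (chart_vector a x (delta_mx 0 j)).

(* [form_closed] is the coordinate expression of d omega = 0. *)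
Record symplectic_form := SymplecticForm {
  form :> M -> tangent -> tangent -> R ;
  form_linear : forall p c (u v w : tangent),
    form p (c *: u + v) w = c * form p u w + form p v w ;
  form_alternating : forall p (u v : tangent), form p u v = - form p v u ;
  form_nondegenerate : forall p (u : tangent),
    (forall v, form p u v = 0) -> u = 0 ;
  form_smooth : forall a i j, atlas X a ->
    smooth_on (chart_cod a) (form_coord form a i j) ;
  form_closed : forall a i j k x, atlas X a -> chart_cod a x ->
    'D_(delta_mx 0 i) (form_coord form a j k) x +
    'D_(delta_mx 0 j) (form_coord form a k i) x +
    'D_(delta_mx 0 k) (form_coord form a i j) x = 0 }.

Variable omega : symplectic_form.

Definition is_sgrad (F : M -> R) (p : M) (v : tangent) : Prop :=
  forall w : tangent, omega p v w = - differential F p w.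

(* For smooth F, nondegeneracy of omega provides exactly one such v. *)
Definition sgrad (F : M -> R) (p : M) : tangent :=
  xget 0 [set v | is_sgrad F p v].

Definition bracket (F G : M -> R) (p : M) : R := omega p (sgrad G p) (sgrad F p).

(* For continuous F on a nonempty compact M the supremum is a maximum. *)
Definition sup_norm (F : M -> R) : R := sup [set `|F p| | p in [set: M]].

Definition distance (P Q : (M -> R) * (M -> R)) : R :=
  sup_norm (P.1 \- Q.1) + sup_norm (P.2 \- Q.2).

Definition almost_commuting (s : R) : set ((M -> R) * (M -> R)) :=
  [set P | [/\ smooth P.1, smooth P.2 & sup_norm (bracket P.1 P.2) <= s]].

Definition profile (F G : M -> R) (s : R) : R :=
  inf [set distance (F, G) P | P in almost_commuting s].

End manifold.

(* Main.v *)
(* Let Phi = (H, K) be almost commuting.  In a chart the Jacobian of Phi is the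
   bracket {H, K} times the density of omega, so Phi has image of area at most a
   constant times s.  Hence, for eps a large multiple of sqrt s, some translate
   of the lattice eps Z^2 avoids the image of Phi.  The punctured plane R^2 - Z^2
   is mapped into a grid of horizontal and vertical lines by a smooth map of rank
   at most one and bounded displacement; its components are staircases, steep near the
   integers, of which at every point at least one is locally constant.
   Composing the rescaled Phi with this map gives a commuting pair at distance
   O(eps) from (H, K), which bounds rho(0) - rho(s). *)
From HB Require Import structures.
Require Import Defs.
From mathcomp Require Import all_boot all_order all_algebra.
From mathcomp Require Import all_classical all_reals all_analysis.
From mathcomp Require Import measurable_realfun ring lra.

Set Implicit Arguments.
Unset Strict Implicit.
Unset Printing Implicit Defensive.

Import Order.TTheory GRing.Theory Num.Theory.
Import numFieldNormedType.Exports.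

Local Open Scope classical_set_scope.
Local Open Scope ring_scope.

(** * Flat functions and closure of smoothness *)

(** The square root comes from homogeneity: scaling both functions by 1/e divides their bracket by
    e^2. It therefore suffices to find one threshold [sigma], the same for all pairs, below which a
    commuting pair lies within uniform distance 2. The size of the functions must not enter, so
    image area is counted modulo the lattice, in the unit square of offsets. No area formula for
    smooth maps is invoked: differentiability at a single point puts the image of a small square in
    a parallelogram controlled by the Jacobian, and bisection assembles these local bounds. The
    image misses the lattice, but with no uniform gap. Strips of constant width around the integers
    would cross near lattice points, and both staircases would vary there; hence the width of a
    strip depends on the other coordinate and shrinks to zero at lattice points, the only places
    where the construction breaks down. *)

Section near_differentiable.
Context {R : numFieldType} {V W : normedModType R}.

Lemma near_eq_differentiable (f g : V -> W) (x : V) :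
  {near x, f =1 g} -> differentiable f x -> differentiable g x.
Proof.
move=> fg df.
have fgx : f x = g x := nbhs_singleton fg.
have cd : continuous ('d f x) by exact: diff_continuous.
have eg : g \o shift x = cst (g x) + 'd f x +o_ 0 id.
  apply/eqaddoP => e e0.
  move/diff_locally: df => /eqaddoP /(_ e e0).
  apply: filter_app.
  have : \forall h \near (0 : V), f (h + x) = g (h + x).
    by move: fg; rewrite (near_shift 0) subr0.
  apply: filterS => h fgh.
  by rewrite !fctE /= fgh fgx.
by apply/diff_locallyP; rewrite (diff_unique cd eg).
Qed.
End near_differentiable.

Section flat.
Context {R : realType}.

(** The factor x^-k makes the family over k closed under differentiation up to linear combinations,
    which exp(-1/x) alone is not. *)
Definition flat (k : nat) (x : R) : R :=
  if 0 < x then x^-1 ^+ k * expR (- x^-1) else 0.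

Lemma flat_eq0 k (x : R) : x <= 0 -> flat k x = 0.
Proof. by rewrite /flat leNgt => /negbTE ->. Qed.

Lemma flat_ge0 k (x : R) : 0 <= flat k x.
Proof.
rewrite /flat; case: ifP => // x0.
by rewrite mulr_ge0 ?expR_ge0 ?exprn_ge0 ?invr_ge0 ?ltW.
Qed.

Lemma flat_gt0 k (x : R) : 0 < x -> 0 < flat k x.
Proof.
by move=> x0; rewrite /flat x0 mulr_gt0 ?expR_gt0 ?exprn_gt0 ?invr_gt0.
Qed.

(** One term of the exponential series, exp(1/x) >= x^-(k+2) / (k+2)!, absorbs the negative power
    and leaves x^2 to spare. This yields continuity at 0. *)
Lemma flat_le k (x : R) : flat k x <= (k.+2)`!%:R * x ^+ 2.
Proof.
rewrite /flat; case: ifP => x0; last by rewrite mulr_ge0 // sqr_ge0.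
have xV0 : 0 < x^-1 by rewrite invr_gt0.
have f0 : 0 < (k.+2)`!%:R :> R by rewrite ltr0n fact_gt0.
rewrite expRN ler_pdivrMr ?expR_gt0//.
have := expR_ge1Dxn k.+1 (ltW xV0).
set e := expR _ => le_e.
have {le_e} : x^-1 ^+ k.+2 / (k.+2)`!%:R <= e.
  by apply: le_trans le_e; rewrite lerDr.
rewrite ler_pdivrMr// => le_e.
have -> : x^-1 ^+ k = x ^+ 2 * x^-1 ^+ k.+2.
  by rewrite !exprS; field; rewrite gt_eqF.
by rewrite (mulrC _ (x ^+ 2)) -(mulrA (x ^+ 2)) ler_pM2l ?exprn_gt0// mulrC.
Qed.

Lemma is_derive_flat k (x : R) :
  is_derive x 1 (flat k) (flat k.+2 x - k%:R * flat k.+1 x).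
Proof.
have [x0|x0|->] := ltgtP x 0.
- rewrite !flat_eq0 ?(ltW x0)// mulr0 subr0.
  apply: (@near_eq_is_derive _ _ _ (cst 0)).
  by near=> y; rewrite flat_eq0 //; near: y; exact: lt_le_nbhsl.
- have xn0 : x != 0 by rewrite gt_eqF.
  have dV : is_derive x 1 (fun y : R => y^-1) (- x ^- 2).
    apply: is_derive_eq; first exact: (@is_deriveV _ id).
    by rewrite /GRing.scale /= mulr1.
  have dE : is_derive x 1 (expR \o (fun y : R => - y^-1)) (expR (- x^-1) * x ^- 2).
    by apply: is_derive1_comp; apply: is_derive_eq; rewrite opprK.
  have dX : is_derive x 1 ((fun y : R => y^-1) ^+ k) (k%:R * x^-1 ^+ k.-1 * (- x ^- 2)).
    case: k => [|k]; first by rewrite expr0 !mul0r; exact: is_derive_cst.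
    by apply: is_derive_eq; rewrite /GRing.scale /= -mulr_natl.
  have dM : is_derive x 1 (fun y : R => y^-1 ^+ k * expR (- y^-1))
      (flat k.+2 x - k%:R * flat k.+1 x).
    rewrite (_ : (fun y => _) = (fun y : R => y^-1) ^+ k * (expR \o (fun y : R => - y^-1))); last first.
      by apply/funext => y; rewrite fctE /= exprfctE.
    apply: is_derive_eq; rewrite /flat x0 /GRing.scale /= exprfctE.
    case: k {dX} => [|k]; rewrite /= !exprS; field => //.
  apply: near_eq_is_derive dM.
  by near=> y; rewrite /flat ifT//; near: y; exact: lt_nbhsr.
- rewrite !flat_eq0// mulr0 subr0.
  (* At 0 the slope function is [flat k.+1], because flat k z = z * flat k.+1 z. *)
  apply/is_derive1_caratheodory; exists (flat k.+1); split.
  + move=> z; rewrite (flat_eq0 _ (lexx 0)) !subr0 /flat; case: ifPn => z0; last by rewrite mul0r.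
    by rewrite exprS; field; rewrite gt_eqF.
  + rewrite /prop_for /continuous_at flat_eq0//.
    apply: (@squeeze_cvgr _ _ _ _ (cst 0) (fun y : R => (k.+3)`!%:R * y ^+ 2)).
    * by near=> y; rewrite flat_ge0 flat_le.
    * exact: cvg_cst.
    * rewrite -[X in _ --> X](mulr0 ((k.+3)`!%:R)); apply: cvgM; first exact: cvg_cst.
      rewrite -[X in _ --> X](expr0n R 2); exact: exprn_continuous.
  + by rewrite flat_eq0.
Unshelve. all: by end_near. Qed.
End flat.

Lemma derive_comp1 {R : realType} {V : normedModType R} (h : R -> R) (g : V -> R)
    (x v : V) (h' : R) :
  is_derive (g x) 1 h h' -> differentiable g x ->
  differentiable (h \o g) x /\ 'D_v (h \o g) x = h' * 'D_v g x.
Proof.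
move=> [dh <-] dg; have dh' : differentiable h (g x) by exact/derivable1_diffP.
have dhg : differentiable (h \o g) x by exact: differentiable_comp.
split=> //; rewrite (deriveE _ dhg) (deriveE _ dg) diff_comp//= diff1E//.
by rewrite derive1E /GRing.scale /= mulrC.
Qed.

Section smooth_closure.
Context {R : realType} {n : nat}.
Variable U : set 'rV[R]_n.
Hypothesis U_open : open U.

Lemma smooth_on_differentiable (f : 'rV[R]_n -> R) x :
  smooth_on U f -> U x -> differentiable f x.
Proof. by move=> sf; exact: (sf [::]). Qed.

Lemma smooth_on_partial (f : 'rV[R]_n -> R) i :
  smooth_on U f -> smooth_on U (fun x => 'D_(delta_mx 0 i) f x).
Proof.
move=> sf s x Ux; have := sf (rcons s i) x Ux.
by rewrite /iter_partial foldr_rcons.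
Qed.

(** A class stable under partial derivatives: once every term is differentiable on U, so are all its
    iterated partials, and no higher chain rule has to be expanded. Stability is the reason for the
    index in [SmoothFlat] and for having sine and cosine together. *)
Inductive smooth_term : ('rV[R]_n -> R) -> Prop :=
| SmoothBase f : smooth_on U f -> smooth_term f
| SmoothCst c : smooth_term (fun=> c)
| SmoothAdd f g : smooth_term f -> smooth_term g ->
    smooth_term (fun x => f x + g x)
| SmoothMul f g : smooth_term f -> smooth_term g ->
    smooth_term (fun x => f x * g x)
| SmoothInv f : (forall x, U x -> f x != 0) -> smooth_term f ->
    smooth_term (fun x => (f x)^-1)
| SmoothSin f : smooth_term f -> smooth_term (fun x => sin (f x))
| SmoothCos f : smooth_term f -> smooth_term (fun x => cos (f x))
| SmoothFlat k f : smooth_term f -> smooth_term (fun x => flat k (f x)).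

Lemma smooth_term_partial f : smooth_term f ->
  (forall x, U x -> differentiable f x) /\
  forall i, exists2 g, smooth_term g & forall x, U x -> 'D_(delta_mx 0 i) f x = g x.
Proof.
elim=> {f} [f sf|c|f g _ [df pf] _ [dg pg]
  |f g sf [df pf] sg [dg pg]|f f0 sf [df pf]
  |f sf [df pf]|f sf [df pf]|k f sf [df pf]].
- split=> [x|i]; first exact: smooth_on_differentiable.
  by exists (fun x => 'D_(delta_mx 0 i) f x) => //; exact/SmoothBase/smooth_on_partial.
- split=> [x _|i]; first exact: differentiable_cst.
  by exists (fun=> 0); [exact: SmoothCst|move=> x _; exact: derive_cst].
- split=> [x Ux|i]; first exact: differentiableD (df _ Ux) (dg _ Ux).
  have [[f' sf' Df] [g' sg' Dg]] := (pf i, pg i).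
  exists (fun x => f' x + g' x) => [|x Ux]; first exact: SmoothAdd.
  by rewrite deriveD ?Df ?Dg//; apply: diff_derivable; [exact: df|exact: dg].
- split=> [x Ux|i]; first exact: differentiableM (df _ Ux) (dg _ Ux).
  have [[f' sf' Df] [g' sg' Dg]] := (pf i, pg i).
  exists (fun x => f x * g' x + g x * f' x) => [|x Ux].
    by apply: SmoothAdd; exact: SmoothMul.
  by rewrite deriveM ?Df ?Dg//; apply: diff_derivable; [exact: df|exact: dg].
- split=> [x Ux|i]; first exact: differentiableV (df _ Ux) (f0 _ Ux).
  have [f' sf' Df] := pf i.
  exists (fun x => (-1 * ((f x)^-1 * (f x)^-1)) * f' x) => [|x Ux].
    apply: SmoothMul => //; apply: SmoothMul; first exact: SmoothCst.
    by apply: SmoothMul; exact: SmoothInv.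
  rewrite deriveV ?f0 ?Df//; last exact/diff_derivable/df.
  by rewrite /GRing.scale /= expr2 invfM mulN1r.
- have D i x (Ux : U x) := derive_comp1 (delta_mx 0 i) (is_derive_sin (f x)) (df _ Ux).
  split=> [x Ux|i]; first by case: (derive_comp1 0 (is_derive_sin (f x)) (df _ Ux)).
  have [f' sf' Df] := pf i.
  exists (fun x => cos (f x) * f' x) => [|x Ux].
    by apply: SmoothMul => //; exact: SmoothCos.
  by case: (D i x Ux) => _ ->; rewrite Df.
- have D i x (Ux : U x) := derive_comp1 (delta_mx 0 i) (is_derive_cos (f x)) (df _ Ux).
  split=> [x Ux|i]; first by case: (derive_comp1 0 (is_derive_cos (f x)) (df _ Ux)).
  have [f' sf' Df] := pf i.
  exists (fun x => (-1 * sin (f x)) * f' x) => [|x Ux].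
    by do 2 apply: SmoothMul => //; [exact: SmoothCst|exact: SmoothSin].
  by case: (D i x Ux) => _ ->; rewrite Df// mulN1r.
- have D i x (Ux : U x) := derive_comp1 (delta_mx 0 i) (is_derive_flat k (f x)) (df _ Ux).
  split=> [x Ux|i]; first by case: (derive_comp1 0 (is_derive_flat k (f x)) (df _ Ux)).
  have [f' sf' Df] := pf i.
  exists (fun x => (flat k.+2 (f x) + (- k%:R) * flat k.+1 (f x)) * f' x) => [|x Ux].
    apply: SmoothMul => //; apply: SmoothAdd; first exact: SmoothFlat.
    by apply: SmoothMul; [exact: SmoothCst|exact: SmoothFlat].
  by case: (D i x Ux) => _ ->; rewrite Df// mulNr.
Qed.

Lemma smooth_term_smooth f : smooth_term f -> smooth_on U f.
Proof.
move=> sf s.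
have [g sg Dg] : exists2 g, smooth_term g &
    forall x, U x -> iter_partial s f x = g x.
  elim: s => [|i s [g sg Dg]]; first by exists f.
  have [dg /(_ i) [g' sg' Dg']] := smooth_term_partial sg.
  (* Agreement on the open set U is agreement near x, so it passes to derivatives. *)
  exists g' => // x Ux; rewrite -Dg'//=; apply: near_eq_derive.
  by apply: filterS (open_nbhs_nbhs (conj U_open Ux)) => y Uy; exact: Dg.
move=> x Ux; apply: (@near_eq_differentiable _ _ _ g).
  by apply: filterS (open_nbhs_nbhs (conj U_open Ux)) => y Uy; rewrite Dg.
by case: (smooth_term_partial sg) => + _; apply.
Qed.

End smooth_closure.

(** * Staircases *)

Section staircase.
Context {R : realType}.
Implicit Types t w x y z : R.

(* A smooth step in [t] from 0 to 1 across [-w, w]; the flat function makes it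
   smooth also at [w = 0], except at the origin. *)
Definition step t w : R :=
  flat 0 (w + t) / (flat 0 (w + t) + flat 0 (w - t)).

Lemma step_den_neq0 t w : 0 < w \/ 0 <= w /\ t != 0 ->
  flat 0 (w + t) + flat 0 (w - t) != 0.
Proof.
move=> wt; have [wt0|wt0] := ltP 0 (w + t).
  by rewrite gt_eqF// ltr_pwDl ?flat_gt0 ?flat_ge0.
have wt1 : 0 < w - t by case: wt => [|[w0 /eqP t0]]; lra.
by rewrite gt_eqF// ltr_wpDl ?flat_gt0 ?flat_ge0.
Qed.

Lemma step_ge0 t w : 0 <= step t w.
Proof. by rewrite divr_ge0 ?addr_ge0 ?flat_ge0. Qed.

Lemma step_le1 t w : step t w <= 1.
Proof.
rewrite /step; have [->|n0] := eqVneq (flat 0 (w + t) + flat 0 (w - t)) 0.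
  by rewrite invr0 mulr0.
by rewrite ler_pdivrMr ?mul1r ?lerDl ?flat_ge0// lt0r n0 addr_ge0 ?flat_ge0.
Qed.

Lemma step_eq1 t w : - t < w <= t -> step t w = 1.
Proof.
move=> /andP[tw wt]; rewrite /step (@flat_eq0 _ 0 (w - t)); last by lra.
by rewrite addr0 divff// gt_eqF// flat_gt0; lra.
Qed.

Lemma step_eq0 t w : w <= - t -> step t w = 0.
Proof. by move=> tw; rewrite /step flat_eq0 ?mul0r; lra. Qed.

Definition stair n x w : R := \sum_(0 <= m < n) step (x - m%:R) w.

(** Since w <= 1, each step lies between a unit ramp rising on [1, 2] and one rising on [-2, -1].
    Sums of such ramps telescope, leaving at least x - 1 and at most x + 2. *)
Lemma stair_dist n x w : 0 <= x <= n%:R -> 0 <= w <= 1 ->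
  `|stair n x w - x| <= 2.
Proof.
move=> /andP[x0 xn] /andP[w0 w1]; pose r t : R := Num.max t 0.
have rE t : r t = t /\ 0 <= t \/ r t = 0 /\ t <= 0.
  by rewrite /r; case: (leP t 0) => ?; [right|left]; lra.
have lo t : r (t - 1) - r (t - 2) <= step t w.
  have := step_ge0 t w; have [t1|t1] := lerP t 1.
    by case: (rE (t - 1)); case: (rE (t - 2)); lra.
  rewrite step_eq1; last by lra.
  by case: (rE (t - 1)); case: (rE (t - 2)); lra.
have hi t : step t w <= r (t + 2) - r (t + 1).
  have := step_le1 t w; have [t1|t1] := lerP (-1) t.
    by case: (rE (t + 1)); case: (rE (t + 2)); lra.
  rewrite step_eq0; last by lra.
  by case: (rE (t + 1)); case: (rE (t + 2)); lra.
have tele y : \sum_(0 <= m < n) (r (y - m%:R) - r (y - m%:R - 1)) =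
    r y - r (y - n%:R).
  rewrite (telescope_sumr_eq (fun m => - r (y - m%:R)))//.
    by rewrite subr0 opprK addrC.
  move=> k _; rewrite -(natr1 k) (_ : y - (k%:R + 1) = y - k%:R - 1); last by ring.
  by rewrite opprK addrC.
have sum_lo : r (x - 1) - r (x - 1 - n%:R) <= stair n x w.
  rewrite -tele; apply: ler_sum => m _; apply: le_trans (lo (x - m%:R)).
  by rewrite (_ : x - 1 - m%:R = x - m%:R - 1) 1?(_ : x - m%:R - 1 - 1 = x - m%:R - 2)//; ring.
have sum_hi : stair n x w <= r (x + 2) - r (x + 2 - n%:R).
  rewrite -tele; apply: ler_sum => m _; apply: le_trans (hi (x - m%:R)) _.
  by rewrite (_ : x + 2 - m%:R = x - m%:R + 2) 1?(_ : x - m%:R + 2 - 1 = x - m%:R + 1)//; ring.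
rewrite ler_norml; move: sum_lo sum_hi.
by case: (rE (x - 1)); case: (rE (x - 1 - n%:R)); case: (rE (x + 2)); case: (rE (x + 2 - n%:R)); lra.
Qed.

(** A smooth function that vanishes exactly at the integers. The 1/8 makes it at most half the
    distance to any integer: sin^2 <= |sin| <= pi |z| <= 4 |z|. *)
Definition width y : R := sin (pi * y) ^+ 2 / 8.

Lemma width_ge0 y : 0 <= width y.
Proof. by rewrite divr_ge0 ?sqr_ge0. Qed.

Lemma width_le1 y : width y <= 1.
Proof.
rewrite /width; have := sin_max (pi * y).
rewrite -(@ler_sqr _ `|_|) ?nnegrE// real_normK ?num_real// expr1n; lra.
Qed.

Lemma norm_sin_le t : `|sin t| <= `|t|.
Proof.
wlog t0 : t / 0 <= t => [th|].
  have [/th//|/ltW t0] := lerP 0 t.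
  by have := th (- t); rewrite sinN !normrN oppr_ge0; apply.
have cs : {within `[0, t], continuous (@sin R)}.
  by apply: continuous_subspaceT; exact: continuous_sin.
have [c _] := MVT_segment t0 (fun x _ => is_derive_sin x) cs.
rewrite sin0 !subr0 => ->; rewrite normrM ler_piMl ?normr_ge0//.
exact: cos_max.
Qed.

Lemma sin_pi_int_sqr y (k : int) : sin (pi * (y - k%:~R)) ^+ 2 = sin (pi * y) ^+ 2.
Proof.
have nat_case z (n : nat) : sin (pi * (z + n%:R)) ^+ 2 = sin (pi * z) ^+ 2.
  rewrite mulrDr mulr_natr (alternatingn (@sinDpi R)) exprMn.
  by rewrite sqrr_sign mul1r.
case: k => n.
  by rewrite -[in RHS](subrK n%:R y) nat_case.
by rewrite NegzE mulrNz opprK nat_case.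
Qed.

Lemma width_le y (k : int) : width y <= `|y - k%:~R| / 2.
Proof.
rewrite /width -(sin_pi_int_sqr y k); set z := y - _.
have := norm_sin_le (pi * z); have := sin_max (pi * z).
rewrite normrM (ger0_norm (pi_ge0 R)).
have /andP[_ p4] := @pihalf_02 R.
rewrite -real_normK ?num_real//; set s := `|sin _| => s1 sz.
have s0 : 0 <= s := normr_ge0 _.
have z0 : 0 <= `|z| := normr_ge0 _.
nra.
Qed.

Lemma width_eq0 y : width y <= 0 -> exists k : int, y = k%:~R.
Proof.
move=> w0; exists (Num.floor y); apply/eqP; apply: contraTT w0 => yn.
have /andP[fy yf] := floor_itv y.
rewrite -ltNge /width -(sin_pi_int_sqr y (Num.floor y)).
rewrite divr_gt0// exprn_gt0// sin_gt0_pi//.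
apply/andP; split; first by rewrite mulr_gt0 ?pi_gt0// subr_gt0 lt_neqAle eq_sym yn.
by rewrite gtr_pMr ?pi_gt0// ltrBlDl -intrD1.
Qed.

(* Away from the lattice, the strips [|x - m| <= width y] and
   [|y - n| <= width x] on which the two staircases vary are disjoint. *)
Lemma strips_disjoint x y :
  (forall k l : int, ~ (x = k%:~R /\ y = l%:~R)) ->
  (forall k : int, width y < `|x - k%:~R|) \/
  (forall l : int, width x < `|y - l%:~R|).
Proof.
move=> xy; apply: contrapT => /not_orP[/existsNP[k /negP +] /existsNP[l /negP]].
rewrite -!leNgt => xk yl.
have := width_le x k; have := width_le y l => wy wx.
have x0 := normr_ge0 (x - k%:~R); have y0 := normr_ge0 (y - l%:~R).
apply: (xy k l); split; apply/eqP; rewrite -subr_eq0 -normr_eq0; apply/eqP; lra.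
Qed.

End staircase.

Section local_constancy.
Context {R : realType} {T : topologicalType}.

Definition near_cst (f : T -> R) (p : T) := exists c, \forall q \near p, f q = c.

(** The strict inequalities are open conditions, so near p each step of the sum keeps its value 0 or
    1. *)
Lemma near_cst_stair n (f g : T -> R) p :
  {for p, continuous f} -> {for p, continuous g} ->
  (forall k : int, width (g p) < `|f p - k%:~R|) ->
  near_cst (fun q => stair n (f q) (width (g q))) p.
Proof.
move=> cf cg far.
have cw : {for p, continuous (fun q => width (g q))}.
  rewrite /width; apply: cvgM; last exact: cvg_cst.
  apply: (@cvg_comp _ _ _ (fun q => sin (pi * g q)) (fun t => t ^+ 2)); last exact: exprn_continuous.
  apply: (@cvg_comp _ _ _ (fun q => pi * g q) sin); last exact: continuous_sin.
  by apply: cvgM => //; exact: cvg_cst.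
elim: n => [|n [c IH]].
  by exists 0; near=> q; rewrite /stair big_geq.
pose d := if 0 < f p - n%:R then 1 else 0 : R.
have ct : {for p, continuous (fun q => f q - n%:R)}.
  by apply: cvgB => //; exact: cvg_cst.
have w0 := @width_ge0 R (g p); have := far n; rewrite -pmulrn => wn.
have stepE : \forall q \near p, step (f q - n%:R) (width (g q)) = d.
  move: wn; rewrite /d; case: ifPn => t0.
    rewrite gtr0_norm// => wt.
    have wt' : 0 < f p - n%:R - width (g p) by lra.
    apply: filterS (cvgr_gt _ (cvgB ct cw) _ wt') => q; rewrite !fctE => ?.
    by rewrite step_eq1//; have := @width_ge0 R (g q); lra.
  rewrite ler0_norm ?leNgt// => wt.
  have wt' : f p - n%:R + width (g p) < 0 by lra.
  apply: filterS (cvgr_lt _ (cvgD ct cw) _ wt') => q; rewrite !fctE => ?.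
  by apply: step_eq0; lra.
exists (c + d); apply: filterS2 IH stepE => q cq dq.
by rewrite /stair big_nat_recr//= dq -cq.
Unshelve. all: by end_near. Qed.

End local_constancy.

(** * Covering the unit square by sheared boxes *)

Section boxes.
Context {R : realType}.

(** Integration of the hypothesis over [0, 1], each interval having measure 2 r. The weights allow
    the lemma to be iterated, one coordinate at a time. *)
Lemma weighted_cover (I : Type) (s : seq I) (u r b : I -> R) (c : R) :
  (forall i, 0 <= r i) -> (forall i, 0 <= b i) -> 0 <= c ->
  (forall x : R, 0 <= x <= 1 -> c <= \sum_(i <- s) b i * (`|x - u i| <= r i)%R%:R) ->
  c <= \sum_(i <- s) b i * (2 * r i).
Proof.
move=> r0 b0 c0 cover.
pose mu := @lebesgue_measure R.
pose J i : set R := `[u i - r i, u i + r i]%classic.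
have JE i x : (`|x - u i| <= r i)%R%:R = \1_(J i) x :> R.
  rewrite indicE /J; congr (nat_of_bool _)%:R.
  rewrite ler_distl; apply/idP/idP; first by move=> h; rewrite inE /= in_itv.
  by rewrite inE /= in_itv.
have mJ i : measurable (J i) by exact: measurable_itv.
have muJ i : mu (J i) = (2 * r i)%:E.
  rewrite /mu /J lebesgue_measure_itv /= lte_fin.
  case: ltP => h; first by rewrite -EFinB; congr EFin; ring.
  by congr EFin; have := r0 i; lra.
have mf i : measurable_fun setT (fun x : R => (b i * \1_(J i) x)%:E).
  by apply/measurable_EFinP; apply: measurable_funM => //; apply: measurable_indic.
have lhs : (\int[mu]_(x in `[0%R, 1%R]) c%:E = c%:E)%E.
  rewrite integral_cst//= /mu lebesgue_measure_itv /= lte_fin ltr01.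
  by rewrite -EFinB -EFinM; congr EFin; ring.
rewrite -lee_fin -lhs.
apply: (@le_trans _ _ (\int[mu]_x (\sum_(i <- s) (b i * \1_(J i) x)%:E))%E).
  apply: (@le_trans _ _ (\int[mu]_(x in `[0%R, 1%R]) (\sum_(i <- s) (b i * \1_(J i) x)%:E))%E).
    apply: ge0_le_integral => //.
    - by apply: emeasurable_sum => i; apply: measurable_funTS; exact: mf.
    - move=> x; rewrite /= in_itv /= => x01; rewrite sumEFin lee_fin.
      by apply: le_trans (cover x x01) _; apply: ler_sum => i _; rewrite JE.
  apply: ge0_subset_integral => //.
  - apply: emeasurable_sum => i. exact: mf.
  - by move=> x _; rewrite sumEFin lee_fin sumr_ge0// => i _; rewrite mulr_ge0.
rewrite ge0_integral_sum//; last first.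
  by move=> i x _; rewrite lee_fin mulr_ge0.
rewrite -sumEFin lee_sum// => i _.
under eq_integral do rewrite EFinM.
rewrite ge0_integralZl_EFin//; last first.
  by apply/measurable_EFinP; apply: measurable_indic; exact: mJ.
rewrite integral_indic//; last exact: mJ.
by rewrite setIT -[X in (_ * X <= _)%E]/(mu (J i)) muJ.
Qed.

(** A parallelogram with two vertical sides: its vertical slices have length 2 h whatever the slope,
    so its area is 4 r h. *)
Record box := Box {
  box_u : R ; box_v : R ; box_slope : R ; box_r : R ; box_h : R ;
  box_r_ge0 : 0 <= box_r ; box_h_ge0 : 0 <= box_h }.

Definition in_box (B : box) (x y : R) : bool :=
  (`|x - box_u B| <= box_r B) && (`|y - box_slope B * x - box_v B| <= box_h B).

Definition box_area (B : box) : R := 4 * (box_r B * box_h B).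

(** Fubini for a finite cover: if the square were covered, integrating in y would give slices of
    total length at least 1 at every x, and integrating these in x a total area at least 1. *)
Lemma boxes_miss (s : seq box) : \sum_(B <- s) box_area B < 1 ->
  exists x y : R, [/\ 0 <= x <= 1, 0 <= y <= 1 & ~~ has (fun B => in_box B x y) s].
Proof.
move=> area; apply: contrapT => miss.
have cover (x y : R) : 0 <= x <= 1 -> 0 <= y <= 1 -> has (fun B => in_box B x y) s.
  by move=> x01 y01; apply: contrapT => /negP nh; apply: miss; exists x, y.
move: area; apply/negP; rewrite -leNgt.
have -> : \sum_(B <- s) box_area B = \sum_(B <- s) (2 * box_h B) * (2 * box_r B).
  by apply: eq_bigr => B _; rewrite /box_area; ring.
apply: (weighted_cover (u := box_u)) => // [B|B|x x01]; first exact: box_r_ge0.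
  by rewrite mulr_ge0// box_h_ge0.
have -> : \sum_(B <- s) 2 * box_h B * (`|x - box_u B| <= box_r B)%R%:R =
    \sum_(B <- s) (`|x - box_u B| <= box_r B)%R%:R * (2 * box_h B).
  by apply: eq_bigr => B _; rewrite mulrC.
apply: (weighted_cover (u := fun B => box_slope B * x + box_v B)) => // [B|y y01].
  exact: box_h_ge0.
have := cover x y x01 y01.
elim: s {miss cover} => // B s IH; rewrite big_cons /=.
have s0 : 0 <= \sum_(j <- s) (`|x - box_u j| <= box_r j)%R%:R *
    (`|y - (box_slope j * x + box_v j)| <= box_h j)%R%:R :> R.
  by apply: sumr_ge0 => j _; rewrite mulr_ge0.
have [inB _|_ /= /IH {}IH] := boolP (in_box B x y); last first.
  by apply: le_trans IH _; rewrite lerDr mulr_ge0.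
move: inB; rewrite /in_box => /andP[-> ]; rewrite opprD addrA => ->.
by rewrite mulr1 lerDl.
Qed.

End boxes.

(** * Area of the image of a square *)

Section bisection.
Context {R : realType} {n : nat}.

Definition in_cube (c : 'rV[R]_n) (r : R) (y : 'rV[R]_n) : Prop :=
  forall i, `|y 0 i - c 0 i| <= r.

(* By bisection, a counterexample to [P] shrinks to a point [x], so that area
   bounds need only pointwise differentiability. *)
Lemma cube_induction (P : 'rV[R]_n -> R -> Prop) (c0 : 'rV[R]_n) (r0 : R) :
  0 < r0 ->
  (forall (c : 'rV[R]_n) (r : R), 0 < r ->
    (forall c' : 'rV[R]_n, (forall i, `|c' 0 i - c 0 i| = r / 2) -> P c' (r / 2)) ->
    P c r) ->
  (forall x, in_cube c0 r0 x -> exists2 e : R, 0 < e &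
    forall (c : 'rV[R]_n) (r : R), 0 < r < e -> in_cube c r x -> P c r) ->
  P c0 r0.
Proof.
move=> r0_gt0 subdiv loc; apply: contrapT => nP0.
have halve (q : 'rV[R]_n * R) : exists c' : 'rV[R]_n, 0 < q.2 -> ~ P q.1 q.2 ->
    (forall i, `|c' 0 i - q.1 0 i| = q.2 / 2) /\ ~ P c' (q.2 / 2).
  apply: contrapT => /forallNP nh.
  have [[q0 nPq]|nq] := pselect (0 < q.2 /\ ~ P q.1 q.2); last first.
    by apply: (nh 0) => q0 nPq; case: nq.
  apply: nPq; apply: subdiv => // c' c'P; apply: contrapT => nPc'.
  by apply: (nh c').
have [next nextP] := choice halve.
pose rad (k : nat) : R := r0 / 2 ^+ k.
pose ctr := fix ctr (k : nat) : 'rV[R]_n :=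
  if k is k'.+1 then next (ctr k', rad k') else c0.
have rad_gt0 k : 0 < rad k by rewrite divr_gt0 ?exprn_gt0.
have radS k : rad k.+1 = rad k / 2 by rewrite /rad exprS; field; rewrite ?expf_neq0.
have nPctr k : ~ P (ctr k) (rad k).
  elim: k => [|k IH]; first by rewrite /rad expr0 divr1.
  by have [_] := nextP (ctr k, rad k) (rad_gt0 k) IH; rewrite -radS.
have ctrS k i : `|ctr k.+1 0 i - ctr k 0 i| <= rad k - rad k.+1.
  have [/= -> _] := nextP (ctr k, rad k) (rad_gt0 k) (@nPctr k).
  by rewrite radS; lra.
have nested k l i : (k <= l)%N -> `|ctr l 0 i - ctr k 0 i| <= rad k - rad l.
  move=> /subnKC <-; elim: (l - k)%N => [|m IH]; first by rewrite addn0 !subrr normr0.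
  rewrite addnS; have := ctrS (k + m)%N i; move: IH; rewrite !ler_distl; lra.
have cross k l i : ctr k 0 i - rad k <= ctr l 0 i + rad l.
  have := rad_gt0 k; have := rad_gt0 l.
  by have [kl|/ltnW lk] := leqP k l; [have := nested _ _ i kl|have := nested _ _ i lk];
    rewrite ler_distl; lra.
(* The common point of the nested cubes: coordinatewise the supremum of the left ends, which every
   right end bounds. *)
pose x : 'rV[R]_n := \row_i sup (range (fun k => ctr k 0 i - rad k)).
have xP k : in_cube (ctr k) (rad k) x.
  move=> i; rewrite mxE ler_distl.
  have hs : has_sup (range (fun k => ctr k 0 i - rad k)).
    split; first by exists (ctr 0%N 0 i - rad 0%N); exists 0%N.
    by exists (ctr 0%N 0 i + rad 0%N) => _ [l _ <-]; exact: cross.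
  apply/andP; split.
    by apply: ub_le_sup; [case: hs|exists k].
  by apply: ge_sup; [case: hs|move=> _ [l _ <-]; exact: cross].
have x0 : in_cube c0 r0 x by have := xP 0%N; rewrite /rad expr0 divr1.
have [e e0 eP] := loc x x0.
have [k ke] : exists k, rad k < e.
  exists (Num.truncn (r0 / e)).+1; rewrite /rad ltr_pdivrMr ?exprn_gt0//.
  rewrite mulrC -ltr_pdivrMr//; apply: lt_le_trans (truncnS_gt _) _.
  by rewrite -natrX ler_nat ltnW// ltn_expl.
by apply: (nPctr k); apply: eP (xP k); rewrite rad_gt0.
Qed.

End bisection.

Section area.
Context {R : realType}.
Notation V := 'rV[R]_2.
Implicit Types (f g : V -> R) (x y h : V).

Notation e0 := (delta_mx 0 0 : V).
Notation e1 := (delta_mx 0 1 : V).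

Lemma ord2_cases (i : 'I_2) : i = 0 \/ i = 1.
Proof. by case: i => [[|[|//]]] ?; [left|right]; exact/val_inj. Qed.

Lemma row2E (h : V) : h = h 0 0 *: e0 + h 0 1 *: e1.
Proof.
apply/rowP => i; rewrite !mxE /=.
by have [->|->] := ord2_cases i; rewrite /= ?mulr1 ?mulr0 ?addr0 ?add0r.
Qed.

Lemma derive2E f x (v : V) : differentiable f x ->
  'D_v f x = v 0 0 * 'D_e0 f x + v 0 1 * 'D_e1 f x.
Proof.
move=> df; rewrite [in LHS](row2E v) !deriveE// linearD !linearZ /=.
by [].
Qed.

Lemma differentiable_bound f x (d : R) : differentiable f x -> 0 < d ->
  exists2 e : R, 0 < e & forall h (r : R), (forall i, `|h 0 i| <= r) -> r < e ->
  `|f (h + x) - f x - ('D_e0 f x * h 0 0 + 'D_e1 f x * h 0 1)| <= d * r.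
Proof.
move=> df d0; have /diff_locally /eqaddoP /(_ d d0)/nbhs_ballP[e /= e_gt0 eP] := df.
exists e => // h r hr re.
have hr' : `|h| <= r.
  rewrite /Num.norm /= mx_normrE; apply: bigmax_le => [|[i j] _ /=].
    exact: le_trans (hr 0).
  by rewrite (ord1 i).
have Dh : 'D_e0 f x * h 0 0 + 'D_e1 f x * h 0 1 = 'd f x h.
  by rewrite -deriveE// (derive2E h df) (mulrC (h 0 0)) (mulrC (h 0 1)).
have := eP h; rewrite -ball_normE /= sub0r normrN => /(_ (le_lt_trans hr' re)).
rewrite /= !fctE /= opprD addrA Dh => hle.
by apply: le_trans hle _; rewrite ler_pM2l.
Qed.

(* A linear map of small determinant can still have large entries; shearing by
   [l] makes the product of the side lengths of its image comparable to the
   determinant. *)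
Lemma shear_exists (f1 f2 g1 g2 K : R) : `|f1 * g2 - f2 * g1| <= K ->
  exists l : R, (`|f1| + `|f2|) * (`|g1 - l * f1| + `|g2 - l * f2|) <= 2 * K.
Proof.
have main (a b c d : R) : `|b| <= `|a| -> a != 0 -> `|a * d - b * c| <= K ->
    (`|a| + `|b|) * (`|c - c / a * a| + `|d - c / a * b|) <= 2 * K.
  move=> ba a0; rewrite divfK// subrr normr0 add0r.
  have -> : d - c / a * b = (a * d - b * c) / a by field.
  rewrite normrM normfV => adK; have a_gt0 : 0 < `|a| by rewrite normr_gt0.
  rewrite mulrA ler_pdivrMr//.
  have : 0 <= `|a * d - b * c| := normr_ge0 _.
  move: (`|a * d - b * c|) adK => D DK D0.
  by nra.
move=> dK; have [/eqP|f0] := eqVneq (`|f1| + `|f2|) 0.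
  rewrite paddr_eq0 ?normr_ge0// !normr_eq0 => /andP[/eqP-> /eqP->].
  by exists 0; rewrite normr0 addr0 mul0r mulr_ge0// (le_trans _ dK).
have [f21|/ltW f12] := lerP `|f2| `|f1|.
  exists (g1 / f1); apply: main => //; apply: contraNneq f0 => f10.
  by move: f21; rewrite f10 normr0 normr_le0 => /eqP->; rewrite normr0 addr0.
exists (g2 / f2); rewrite addrC (addrC `|g1 - _|); apply: main => //.
  apply: contraNneq f0 => f20.
  by move: f12; rewrite f20 normr0 normr_le0 => /eqP->; rewrite normr0 addr0.
by rewrite -normrN opprB.
Qed.

(** The hypotheses give z - 2 <= j <= z + 1, which leaves four integers, from floor z - 2 to floor z
    + 1. *)
Lemma floor_window (z t : R) (j : int) : 0 <= t <= 1 ->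
  `|t + j%:~R - z| <= 1 ->
  exists2 i : nat, i \in iota 0 4 & j = Num.floor z - 2 + i.
Proof.
move=> /andP[t0 t1]; rewrite ler_distl => /andP[zl zr].
have /andP[fz zf] := floor_itv z.
have jlo : 0 <= j - (Num.floor z - 2).
  by rewrite subr_ge0 -(ler_int R) intrB; lra.
have jhi : j - (Num.floor z - 2) < 4.
  rewrite -(ltr_int R) !intrB; move: zf; rewrite intrD; lra.
exists (absz (j - (Num.floor z - 2))%R); last first.
  by rewrite gez0_abs// addrC subrK.
by rewrite mem_iota -ltz_nat gez0_abs.
Qed.

Lemma has_allpairs (S T : eqType) (U : Type) (Q : pred U) (b : S -> T -> U)
    (s : seq S) (t : seq T) (x : S) (y : T) :
  x \in s -> y \in t -> Q (b x y) -> has Q [seq b i j | i <- s, j <- t].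
Proof.
move=> + yt Qxy; elim: s => // z s IH; rewrite inE allpairs_cons has_cat.
move=> /predU1P[<-|/IH ->]; last by rewrite orbT.
by rewrite has_map (_ : has _ _)//; apply/hasP; exists y.
Qed.

(* [s] covers the offsets (a, b) in the unit square for which (f, g) meets the
   lattice (a, b) + Z^2 on the square of center [c] and half side [r]. *)
Definition covers_hits f g (s : seq (@box R)) (c : V) (r : R) : Prop :=
  forall y (a b : R) (k l : int), in_cube c r y -> 0 <= a <= 1 -> 0 <= b <= 1 ->
    f y = a + k%:~R -> g y = b + l%:~R -> has (fun B => in_box B a b) s.

(** Up to a small error the pair is affine near x, so after a shear the image of the cube fits in a
    box of half sides 2r(p + d) and 2r(q + dw); the 2r appears because x need not be the center.
    This box has area at most 4 (2r)^2 3K = 48 K r^2, and its 4 * 4 relevant lattice translates give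
    768. *)
Lemma covers_hits_local f g x (K : R) : 0 < K ->
  differentiable f x -> differentiable g x ->
  `|'D_e0 f x * 'D_e1 g x - 'D_e1 f x * 'D_e0 g x| <= K ->
  exists2 e : R, 0 < e & forall (c : V) (r : R), 0 < r < e -> in_cube c r x ->
    exists2 s, \sum_(B <- s) box_area B <= 768 * K * r ^+ 2 & covers_hits f g s c r.
Proof.
move=> K0 df dg detK.
set f1 := 'D_e0 f x in detK *; set f2 := 'D_e1 f x in detK *.
set g1 := 'D_e0 g x in detK *; set g2 := 'D_e1 g x in detK *.
have [m mK] := shear_exists detK.
set p := `|f1| + `|f2| in mK; set q := `|g1 - m * f1| + `|g2 - m * f2| in mK.
have p0 : 0 <= p by rewrite addr_ge0.
have q0 : 0 <= q by rewrite addr_ge0.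
pose p' := `|g1| + `|g2|; have p'0 : 0 <= p' by rewrite addr_ge0.
pose w := 1 + `|m|; have w1 : 1 <= w by rewrite lerDl.
(* [d] is so small that the error terms add at most K to p * q <= 2K. *)
have [d [d0 d1 dK]] : exists d : R, [/\ 0 < d, d <= 1 & (p + d) * (q + d * w) <= 3 * K].
  have S0 : 0 < q + p * w + w by nra.
  pose d := Num.min 1 (K / (q + p * w + w)).
  have d1 : d <= 1 by rewrite /d ge_min lexx.
  have d0 : 0 < d by rewrite /d lt_min ltr01 divr_gt0.
  have dS : d * (q + p * w + w) <= K.
    by rewrite -ler_pdivlMr// /d ge_min lexx orbT.
  exists d; split=> //.
  have : d * (d * w) <= d * w by rewrite ler_pM2l// ler_piMl//; lra.
  have -> : (p + d) * (q + d * w) = p * q + d * (q + p * w + w) + (d * (d * w) - d * w) by ring.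
  by move: mK dS; lra.
have [ef ef0 efP] := differentiable_bound df d0.
have [eg eg0 egP] := differentiable_bound dg d0.
(* Halved because points of the cube differ from x by up to 2r in each coordinate. The inverses keep
   the variation of f and g at most 1, as [floor_window] requires. *)
pose e := Num.min (Num.min ef eg) (Num.min (p + d)^-1 (p' + d)^-1) / 2.
exists e.
  by rewrite /e divr_gt0// !lt_min ef0 eg0 !invr_gt0 !ltr_wpDl.
move=> c r /andP[r0 re] cx.
have [ref reg rp rp'] : [/\ 2 * r < ef, 2 * r < eg, 2 * r * (p + d) <= 1 & 2 * r * (p' + d) <= 1].
  move: re; rewrite /e ltr_pdivlMr// mulrC !lt_min => /andP[/andP[-> ->] /andP[h1 h2]].
  split=> //; rewrite -ler_pdivlMr ?ltr_wpDl// div1r; exact: ltW.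
have Ar0 : 0 <= 2 * r * (p + d) by apply: mulr_ge0; lra.
have Br0 : 0 <= 2 * r * (q + d * w).
  by apply: mulr_ge0; [lra|rewrite addr_ge0// mulr_ge0//; lra].
pose kf : int := Num.floor (f x); pose kg : int := Num.floor (g x).
pose bx (i j : nat) : @box R :=
  let k := (kf - 2 + i)%:~R in let l := (kg - 2 + j)%:~R in
  Box (f x - k) ((g x - l) - m * (f x - k)) m Ar0 Br0.
have bxE i j : box_area (bx i j) <= 48 * K * r ^+ 2.
  rewrite /box_area /=.
  have -> : 4 * (2 * r * (p + d) * (2 * r * (q + d * w))) =
     16 * r ^+ 2 * ((p + d) * (q + d * w)) by ring.
  have -> : 48 * K * r ^+ 2 = 16 * r ^+ 2 * (3 * K) by ring.
  by rewrite ler_wpM2l// mulr_ge0// sqr_ge0.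
exists [seq bx i j | i <- iota 0 4, j <- iota 0 4].
  rewrite big_allpairs_dep.
  apply: (@le_trans _ _ (\sum_(i <- iota 0 4) \sum_(j <- iota 0 4) 48 * K * r ^+ 2)).
    by apply: ler_sum => i _; apply: ler_sum => j _; exact: bxE.
  rewrite !big_cons !big_nil; lra.
move=> y a b k l cy /andP[a0 a1] /andP[b0 b1] fy gy.
pose h := y - x; have yE : y = h + x by rewrite subrK.
have hr i : `|h 0 i| <= 2 * r.
  have := cy i; have := cx i; rewrite /h !mxE !ler_norml; lra.
have := efP h _ hr ref; have := egP h _ hr reg.
rewrite -yE -/f1 -/f2 -/g1 -/g2; set Ef := f y - _ - _; set Eg := g y - _ - _ => Egr Efr.
have lin (u v : R) : `|u * h 0 0 + v * h 0 1| <= (`|u| + `|v|) * (2 * r).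
  apply: le_trans (ler_normD _ _) _; rewrite !normrM mulrDl.
  by rewrite lerD// ler_wpM2l.
have dfy : `|f y - f x| <= 2 * r * (p + d).
  have -> : f y - f x = (f1 * h 0 0 + f2 * h 0 1) + Ef by rewrite /Ef; ring.
  apply: le_trans (ler_normD _ _) _; have := lin f1 f2; rewrite -/p; lra.
have dgy : `|g y - g x| <= 2 * r * (p' + d).
  have -> : g y - g x = (g1 * h 0 0 + g2 * h 0 1) + Eg by rewrite /Eg; ring.
  apply: le_trans (ler_normD _ _) _; have := lin g1 g2; rewrite -/p'; lra.
have dgfy : `|g y - g x - m * (f y - f x)| <= 2 * r * (q + d * w).
  have -> : g y - g x - m * (f y - f x) =
      ((g1 - m * f1) * h 0 0 + (g2 - m * f2) * h 0 1) + (Eg - m * Ef).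
    by rewrite /Ef /Eg; ring.
  apply: le_trans (ler_normD _ _) _.
  have := lin (g1 - m * f1) (g2 - m * f2); rewrite -/q => hq.
  have : `|Eg - m * Ef| <= `|Eg| + `|m| * `|Ef| by rewrite -normrM ler_normB.
  have : `|m| * `|Ef| <= `|m| * (d * (2 * r)) by rewrite ler_wpM2l.
  by rewrite /w; lra.
have [i iI kE] : exists2 i : nat, i \in iota 0 4 & k = kf - 2 + i.
  by apply: (@floor_window _ a); [rewrite a0|rewrite -fy; exact: le_trans dfy rp].
have [j jI lE] : exists2 i : nat, i \in iota 0 4 & l = kg - 2 + i.
  by apply: (@floor_window _ b); [rewrite b0|rewrite -gy; exact: le_trans dgy rp'].
apply: (has_allpairs iI jI); rewrite /in_box /= -kE -lE; apply/andP; split.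
  by rewrite (_ : a - _ = f y - f x)// fy; ring.
rewrite (_ : b - _ - _ = g y - g x - m * (f y - f x))//.
by rewrite fy gy; ring.
Qed.

(** The bound is a multiple of r^2, so the bounds of the four quarters add up to that of the square
    with no loss in the constant; their lists of boxes are concatenated. *)
Lemma covers_hits_square f g c (r K : R) : 0 < K -> 0 < r ->
  (forall x, in_cube c r x -> differentiable f x) ->
  (forall x, in_cube c r x -> differentiable g x) ->
  (forall x, in_cube c r x ->
    `|'D_e0 f x * 'D_e1 g x - 'D_e1 f x * 'D_e0 g x| <= K) ->
  exists2 s, \sum_(B <- s) box_area B <= 768 * K * r ^+ 2 & covers_hits f g s c r.
Proof.
move=> K0 r0 df dg detK.
apply: (@cube_induction R 2 (fun c r => exists2 s, \sum_(B <- s) box_area B <=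
  768 * K * r ^+ 2 & covers_hits f g s c r)) => // [c' r' r'0 quarter|x cx].
  pose corner (b0 b1 : bool) : V :=
    \row_j (c' 0 j + (if (if j == 0 then b0 else b1) then 1 else -1) * (r' / 2)).
  have cornerP b0 b1 i : `|corner b0 b1 0 i - c' 0 i| = r' / 2.
    rewrite mxE addrC addKr normrM (ger0_norm (_ : 0 <= r' / 2)); last by lra.
    by case: ifP; rewrite ?normrN normr1 mul1r.
  have pick (b0 b1 : bool) := quarter (corner b0 b1) (cornerP b0 b1).
  have [[stt att ctt] [stf atf ctf] [sft aft cft] [sff aff cff]] :=
    And4 (pick true true) (pick true false) (pick false true) (pick false false).
  exists (stt ++ stf ++ sft ++ sff).
    by rewrite !big_cat /=; move: att atf aft aff; lra.
  move=> y a b k l cy a01 b01 fy gy.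
  have [b0 [b1 cyb]] : exists b0 b1, in_cube (corner b0 b1) (r' / 2) y.
    exists (0 <= y 0 0 - c' 0 0), (0 <= y 0 1 - c' 0 1) => i.
    have half (u v : R) : `|u - v| <= r' ->
        `|u - (v + (if 0 <= u - v then 1 else -1) * (r' / 2))| <= r' / 2.
      by case: ifPn => ?; rewrite !ler_norml; lra.
    rewrite mxE; have [i0|i1] := ord2_cases i.
      by rewrite i0 eqxx; apply: half; exact: cy.
    by rewrite i1; apply: half; exact: cy.
  rewrite !has_cat; move: b0 b1 cyb.
  by move=> [] [] cyb; rewrite 1?(ctt _ _ _ _ _ cyb a01 b01 fy gy)
    1?(ctf _ _ _ _ _ cyb a01 b01 fy gy) 1?(cft _ _ _ _ _ cyb a01 b01 fy gy)
    1?(cff _ _ _ _ _ cyb a01 b01 fy gy) ?orbT.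
by apply: covers_hits_local => //; [exact: df|exact: dg|exact: detK].
Qed.

End area.

(** * Charts and the Poisson bracket *)

Lemma near_eq_continuous {T U : topologicalType} (f g : T -> U) (x : T) :
  {near x, f =1 g} -> {for x, continuous f} -> {for x, continuous g}.
Proof.
move=> fg; have fgx : f x = g x := nbhs_singleton fg.
rewrite /prop_for /continuous_at -fgx; apply: cvg_trans.
exact: near_eq_cvg.
Qed.

Lemma derive_comp {R : numFieldType} {U V W : normedModType R} (f : U -> V)
    (g : V -> W) (x v : U) :
  differentiable f x -> differentiable g (f x) ->
  'D_v (g \o f) x = 'D_('D_v f x) g (f x).
Proof.
move=> df dg; have dgf : differentiable (g \o f) x by exact: differentiable_comp.
by rewrite (deriveE _ dgf) (deriveE _ dg) (deriveE _ df) diff_comp.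
Qed.

Lemma row2_dependent {R : realType} (u v : 'rV[R]_2) i :
  u 0 0 * v 0 1 - u 0 1 * v 0 0 = 0 -> v 0 i *: u + (- u 0 i) *: v = 0.
Proof.
move=> det0; apply/rowP => j; rewrite !mxE.
by have [->|->] := ord2_cases i; have [->|->] := ord2_cases j; move: det0; lra.
Qed.

Section charts.
Context {R : realType} {n : nat} {M : topologicalType}.
Variable X : smooth_manifold R n M.
Implicit Types (a b : chart R n M) (p : M) (x : 'rV[R]_n).

Lemma chart_inv_cvg a x : chart_cod a x -> {for x, continuous (chart_inv a)}.
Proof.
move=> ax; have := @chart_inv_continuous _ _ _ a.
by rewrite continuous_open_subspace; [apply; exact: mem_set|exact: chart_cod_open].
Qed.

Lemma chart_map_cvg a p : chart_dom a p -> {for p, continuous a}.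
Proof.
move=> ap; have := @chart_map_continuous _ _ _ a.
by rewrite continuous_open_subspace; [apply; exact: mem_set|exact: chart_dom_open].
Qed.

Lemma near_chart_cod a x : chart_cod a x -> \forall y \near x, chart_cod a y.
Proof. by move=> ax; apply: open_nbhs_nbhs; split=> //; exact: chart_cod_open. Qed.

Lemma near_chart_inv_dom a b x : chart_cod a x -> chart_dom b (chart_inv a x) ->
  \forall y \near x, chart_dom b (chart_inv a y).
Proof.
move=> ax bx; apply: (chart_inv_cvg ax).
by apply: open_nbhs_nbhs; split=> //; exact: chart_dom_open.
Qed.

Lemma transition_differentiable a b x : atlas X a -> atlas X b ->
  chart_cod a x -> chart_dom b (chart_inv a x) ->
  differentiable (b \o chart_inv a) x.
Proof.
move=> Xa Xb ax bx; apply: (transition_smooth Xa Xb [::]).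
by exists (chart_inv a x); [split=> //; exact: chart_inv_dom|exact/chart_invK/mem_set].
Qed.

Lemma smooth_chart_differentiable (F : M -> R) a x : smooth X F -> atlas X a ->
  chart_cod a x -> differentiable (F \o chart_inv a) x.
Proof. by move=> sF Xa ax; exact: (sF a Xa [::] x ax). Qed.

Lemma chart_continuous (F : M -> R) a p : chart_dom a p ->
  {for a p, continuous (F \o chart_inv a)} -> {for p, continuous F}.
Proof.
move=> ap cF; apply: (@near_eq_continuous _ _ ((F \o chart_inv a) \o a)).
  have := open_nbhs_nbhs (conj (@chart_dom_open _ _ _ a) ap).
  by apply: filterS => q aq /=; rewrite chart_mapK// mem_set.
exact: continuous_comp (chart_map_cvg ap) cF.
Qed.

Lemma smooth_continuous (F : M -> R) : smooth X F -> continuous F.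
Proof.
move=> sF p; apply: (chart_continuous (chart_at_dom X p)).
apply/differentiable_continuous/smooth_chart_differentiable => //.
  exact: chart_at_atlas.
exact/chart_map_cod/chart_at_dom.
Qed.

(** [differential] is read in the preferred chart, which changes with the point. The chain rule
    through the transition map expresses it in one fixed chart. *)
Lemma derive_chart (F : M -> R) a x (u : 'rV[R]_n) : smooth X F ->
  atlas X a -> chart_cod a x ->
  'D_u (F \o chart_inv a) x =
  differential X F (chart_inv a x) (chart_vector X a x u).
Proof.
move=> sF Xa ax; set p := chart_inv a x; set b := chart_at X p.
have Xb : atlas X b := chart_at_atlas X p.
have bp : chart_dom b p := chart_at_dom X p.
have dt := transition_differentiable Xa Xb ax bp.
have db : differentiable (F \o chart_inv b) ((b \o chart_inv a) x).
  by apply: smooth_chart_differentiable => //; exact: chart_map_cod.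
rewrite /differential /chart_vector -/p -/b.
have -> : 'D_u (F \o chart_inv a) x = 'D_u ((F \o chart_inv b) \o (b \o chart_inv a)) x.
  apply: near_eq_derive; apply: filterS (near_chart_inv_dom ax bp) => y By /=.
  by rewrite chart_mapK// mem_set.
by rewrite (derive_comp _ dt db).
Qed.

(** The reverse transition composes to the identity near x, so its derivative is a left inverse of
    [chart_vector]. *)
Lemma chart_vector_eq0 a x (u : 'rV[R]_n) : atlas X a -> chart_cod a x ->
  chart_vector X a x u = 0 -> u = 0.
Proof.
move=> Xa ax; rewrite /chart_vector; set p := chart_inv a x; set b := chart_at X p.
have Xb : atlas X b := chart_at_atlas X p.
have bp : chart_dom b p := chart_at_dom X p.
have ap : chart_dom a p by exact: chart_inv_dom.
have bbp : chart_inv b (b p) = p by exact/chart_mapK/mem_set.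
have dt := transition_differentiable Xa Xb ax bp.
have dt' : differentiable (a \o chart_inv b) ((b \o chart_inv a) x).
  by apply: transition_differentiable => //; [exact: chart_map_cod|rewrite /= bbp].
move=> u0.
have <- : 'D_u ((a \o chart_inv b) \o (b \o chart_inv a)) x = u.
  rewrite -[RHS](derive_id x); apply: near_eq_derive.
  apply: filterS2 (near_chart_cod ax) (near_chart_inv_dom ax bp) => y ay By /=.
  by rewrite chart_mapK ?chart_invK// mem_set.
by rewrite (derive_comp _ dt dt') u0 derive0.
Qed.

Lemma chart_vectorD a x (c d : R) (u v : 'rV[R]_n) : atlas X a -> chart_cod a x ->
  chart_vector X a x (c *: u + d *: v) =
  c *: chart_vector X a x u + d *: chart_vector X a x v.
Proof.
move=> Xa ax; rewrite /chart_vector.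
have dt := transition_differentiable Xa (chart_at_atlas X _) ax (chart_at_dom X _).
by rewrite !deriveE// linearD !linearZ.
Qed.

End charts.

Section symplectic_surface.
Context {R : realType} {M : topologicalType}.
Variables (X : smooth_manifold R 2 M) (omega : symplectic_form X).
Implicit Types (F G : M -> R) (p : M) (u v w : 'rV[R]_2).

Notation e0 := (delta_mx 0 0 : 'rV[R]_2).
Notation e1 := (delta_mx 0 1 : 'rV[R]_2).

Lemma form_self p u : omega p u u = 0.
Proof. by have := form_alternating omega p u u; lra. Qed.

Lemma form2E p u v :
  omega p u v = omega p e0 e1 * (u 0 0 * v 0 1 - u 0 1 * v 0 0).
Proof.
have linl c d u1 u2 w : omega p (c *: u1 + d *: u2) w =
    c * omega p u1 w + d * omega p u2 w.
  have lin0 : omega p 0 w = 0.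
    by have := form_linear omega p 1 0 0 w; rewrite scaler0 addr0; lra.
  rewrite form_linear; congr (_ + _).
  by have := form_linear omega p d u2 0 w; rewrite addr0 lin0 addr0.
have linr c d u1 u2 w : omega p w (c *: u1 + d *: u2) =
    c * omega p w u1 + d * omega p w u2.
  by rewrite form_alternating linl (form_alternating omega p w u1) (form_alternating omega p w u2); ring.
rewrite [in LHS](row2E u) [in LHS](row2E v) linl !linr !form_self.
by rewrite (form_alternating omega p e1 e0); ring.
Qed.

(** In dimension 2 the form is a multiple of the determinant, and this is the Plücker relation. It
    separates a bracket times a density into products of differentials. *)
Lemma form_plucker p u1 u2 u3 u4 :
  omega p u1 u2 * omega p u3 u4 =
  omega p u1 u3 * omega p u2 u4 - omega p u1 u4 * omega p u2 u3.
Proof.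
rewrite (form2E p u1 u2) (form2E p u3 u4) (form2E p u1 u3) (form2E p u2 u4).
by rewrite (form2E p u1 u4) (form2E p u2 u3); ring.
Qed.

Lemma form_basis_neq0 p : omega p e0 e1 != 0.
Proof.
apply/eqP => w0.
have : e0 = 0 by apply: (@form_nondegenerate _ _ _ _ omega p) => v; rewrite form2E w0 mul0r.
by move/rowP/(_ 0); rewrite !mxE eqxx => /eqP; rewrite oner_eq0.
Qed.

(** A vanishing determinant would give a linear relation between the images of the coordinate
    vectors, against the injectivity of [chart_vector]. *)
Lemma form_coord_neq0 a x : atlas X a -> chart_cod a x ->
  form_coord X omega a 0 1 x != 0.
Proof.
move=> Xa ax; rewrite /form_coord; set p := chart_inv a x.
set u := chart_vector X a x e0; set v := chart_vector X a x e1.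
rewrite form2E mulf_neq0 ?form_basis_neq0//; apply/eqP => det0.
have v0 : v = 0.
  have rel i : chart_vector X a x (v 0 i *: e0 + (- u 0 i) *: e1) = 0.
    by rewrite chart_vectorD// -/u -/v; exact: row2_dependent.
  apply/rowP => i; have /rowP/(_ 0) := chart_vector_eq0 Xa ax (rel i).
  by rewrite !mxE /= mulr1 mulr0 addr0.
have /rowP/(_ 1) := chart_vector_eq0 Xa ax v0.
by rewrite !mxE eqxx => /eqP; rewrite oner_eq0.
Qed.

Lemma sgradP F p : smooth X F -> is_sgrad omega F p (sgrad omega F p).
Proof.
move=> sF; apply: (@xgetPex _ 0 [set v | is_sgrad omega F p v]).
set b := chart_at X p.
have db : differentiable (F \o chart_inv b) (b p).
  apply: (smooth_chart_differentiable sF); first exact: chart_at_atlas.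
  by apply: chart_map_cod; exact: chart_at_dom.
set W := omega p e0 e1; have W0 : W != 0 := form_basis_neq0 p.
(* The solution of the 2 by 2 linear system that [form2E] makes of [is_sgrad]. *)
exists ((- differential X F p e1 / W) *: e0 + (differential X F p e0 / W) *: e1) => w.
rewrite form2E -/W /differential -/b (derive2E w db) !mxE /=.
by rewrite !(mulr0, mulr1, addr0, add0r); field.
Qed.

(** Plücker relation for the two gradients and the two coordinate vectors: each factor on the right
    pairs a gradient with a coordinate vector, hence is a partial derivative up to sign. *)
Lemma bracket_chart F G a x : smooth X F -> smooth X G -> atlas X a ->
  chart_cod a x ->
  bracket omega F G (chart_inv a x) * form_coord X omega a 0 1 x =
  - ('D_e0 (F \o chart_inv a) x * 'D_e1 (G \o chart_inv a) x -
     'D_e1 (F \o chart_inv a) x * 'D_e0 (G \o chart_inv a) x).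
Proof.
move=> sF sG Xa ax; rewrite !(derive_chart _ _ Xa ax)//.
set p := chart_inv a x; rewrite /form_coord -/p.
set u := chart_vector X a x e0; set v := chart_vector X a x e1.
have dF w : differential X F p w = - omega p (sgrad omega F p) w.
  by rewrite (sgradP p sF) opprK.
have dG w : differential X G p w = - omega p (sgrad omega G p) w.
  by rewrite (sgradP p sG) opprK.
rewrite (dF u) (dF v) (dG u) (dG v) /bracket form_plucker.
move: (omega p _ u) (omega p _ v) (omega p _ u) (omega p _ v) => s t s' t'.
by ring.
Qed.

Lemma bracket_scale F G (c : R) p : smooth X F -> smooth X G ->
  smooth X (fun q => c * F q) -> smooth X (fun q => c * G q) ->
  bracket omega (fun q => c * F q) (fun q => c * G q) p = c ^+ 2 * bracket omega F G p.
Proof.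
move=> sF sG scF scG; set a := chart_at X p.
have Xa : atlas X a := chart_at_atlas X p.
have ap : chart_dom a p := chart_at_dom X p.
have cap : chart_cod a (a p) by exact: chart_map_cod.
have pE : chart_inv a (a p) = p by exact/chart_mapK/mem_set.
have := bracket_chart scF scG Xa cap; have := bracket_chart sF sG Xa cap.
rewrite pE => h1 h2; apply: (mulIf (form_coord_neq0 Xa cap)).
rewrite h2 -mulrA h1.
have Dc (H : M -> R) w : smooth X H -> 'D_w ((fun q => c * H q) \o chart_inv a) (a p) =
    c * 'D_w (H \o chart_inv a) (a p).
  move=> sH; rewrite (_ : _ \o _ = c *: (H \o chart_inv a)); last exact/funext.
  by rewrite deriveZ//; apply/diff_derivable; exact: (smooth_chart_differentiable sH Xa cap).
by rewrite !Dc//; ring.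
Qed.

Lemma near_cst_bracket F G p : smooth X F -> smooth X G ->
  near_cst F p \/ near_cst G p -> bracket omega F G p = 0.
Proof.
move=> sF sG; set a := chart_at X p.
have Xa : atlas X a := chart_at_atlas X p.
have ap : chart_dom a p := chart_at_dom X p.
have cap : chart_cod a (a p) by exact: chart_map_cod.
have pE : chart_inv a (a p) = p by exact/chart_mapK/mem_set.
have D0 (H : M -> R) w : near_cst H p -> 'D_w (H \o chart_inv a) (a p) = 0.
  move=> [c Hc]; rewrite -(derive_cst c (a p) w); apply: near_eq_derive.
  have := chart_inv_cvg cap; rewrite /prop_for /continuous_at pE => cv.
  exact: (cv _ Hc).
move=> FG; apply: (mulIf (form_coord_neq0 Xa cap)); rewrite mul0r.
have := bracket_chart sF sG Xa cap; rewrite pE => ->.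
by case: FG => /D0 h; rewrite !h; ring.
Qed.

End symplectic_surface.

(** * Commuting approximation *)

Section smooth_stair.
Context {R : realType} {n : nat} (U : set 'rV[R]_n).

Lemma SmoothSub (f g : 'rV[R]_n -> R) : smooth_term U f -> smooth_term U g ->
  smooth_term U (fun x => f x - g x).
Proof.
move=> sf sg; rewrite (_ : (fun x => f x - g x) = fun x => f x + -1 * g x).
  by apply: SmoothAdd => //; apply: SmoothMul => //; exact: SmoothCst.
by apply/funext => x; rewrite mulN1r.
Qed.

Lemma smooth_term_stair m (f g : 'rV[R]_n -> R) :
  smooth_term U f -> smooth_term U g ->
  (forall x (k l : int), U x -> ~ (f x = k%:~R /\ g x = l%:~R)) ->
  smooth_term U (fun x => stair m (f x) (width (g x))).
Proof.
move=> sf sg off.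
have sw : smooth_term U (fun x => width (g x)).
  apply: SmoothMul; last exact: SmoothCst.
  have ss : smooth_term U (fun x => sin (pi * g x)).
    by apply: SmoothSin; apply: SmoothMul => //; exact: SmoothCst.
  exact: (SmoothMul ss ss).
elim: m => [|m IH].
  rewrite (_ : (fun _ => _) = fun=> 0); first exact: SmoothCst.
  by apply/funext => x; rewrite /stair big_geq.
have st : smooth_term U (fun x => f x - m%:R).
  by apply: SmoothSub => //; exact: SmoothCst.
rewrite (_ : (fun _ => _) = fun x => stair m (f x) (width (g x)) +
    step (f x - m%:R) (width (g x))); last first.
  by apply/funext => x; rewrite /stair big_nat_recr.
apply: SmoothAdd => //; rewrite /step; apply: SmoothMul.
  by apply: SmoothFlat; exact: SmoothAdd.
apply: SmoothInv => [x Ux|]; last first.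
  apply: SmoothAdd; apply: SmoothFlat; [exact: SmoothAdd|exact: SmoothSub].
(* The width vanishes only where g is an integer; there f = m would be a lattice point, which [off]
   excludes. *)
apply: step_den_neq0; have [w0|w0] := ltP 0 (width (g x)); [by left|right].
split; first exact: width_ge0.
have [l gl] := width_eq0 w0; rewrite subr_eq0; apply/eqP => fm.
by apply: (off x m l Ux); rewrite -pmulrn.
Qed.

End smooth_stair.

Section compact_surface.
Context {R : realType} {M : topologicalType}.
Variables (X : smooth_manifold R 2 M) (omega : symplectic_form X).
Hypothesis M_nonempty : [set: M] !=set0.
Hypothesis M_compact : compact [set: M].

Notation e0 := (delta_mx 0 0 : 'rV[R]_2).
Notation e1 := (delta_mx 0 1 : 'rV[R]_2).

Lemma continuous_bounded (F : M -> R) : continuous F ->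
  exists c : R, forall p, `|F p| <= c.
Proof.
move=> cF.
have cN : {within [set: M], continuous (fun p => `|F p|)}.
  apply: continuous_subspaceT => p; apply: continuous_comp; first exact: cF.
  exact: norm_continuous.
have [c _ cmax] := compact_EVT_max M_nonempty M_compact cN.
by exists `|F c| => p; apply: cmax; rewrite inE.
Qed.

Lemma smooth_scale (F : M -> R) (c : R) : smooth X F -> smooth X (fun p => c * F p).
Proof.
move=> sF a Xa; apply: smooth_term_smooth; first exact: chart_cod_open.
apply: (@SmoothMul _ _ _ (fun=> c) (F \o chart_inv a)); first exact: SmoothCst.
exact/SmoothBase/sF.
Qed.

Lemma smooth_cst (c : R) : smooth X (fun=> c).
Proof.
move=> a Xa; apply: smooth_term_smooth; first exact: chart_cod_open.
exact: SmoothCst.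
Qed.

(** [sgrad] is chosen pointwise, so continuity is read off the chart formula. It is what makes
    [sup_norm] of the bracket an actual pointwise bound. *)
Lemma bracket_continuous (F G : M -> R) : smooth X F -> smooth X G ->
  continuous (bracket omega F G).
Proof.
move=> sF sG p; set a := chart_at X p.
have Xa : atlas X a := chart_at_atlas X p.
have ap : chart_dom a p := chart_at_dom X p.
have cap : chart_cod a (a p) by exact: chart_map_cod.
apply: (chart_continuous ap).
have cD (H : M -> R) i : smooth X H ->
    {for a p, continuous (fun y => 'D_(delta_mx 0 i) (H \o chart_inv a) y)}.
  by move=> sH; apply: differentiable_continuous; exact: (sH a Xa [:: i]).
have cW : {for a p, continuous (form_coord X omega a 0 1)}.
  by apply: differentiable_continuous; exact: (form_smooth omega 0 1 Xa [::]).
have W0 := form_coord_neq0 omega Xa cap.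
pose k (y : 'rV[R]_2) : R :=
  - ('D_e0 (F \o chart_inv a) y * 'D_e1 (G \o chart_inv a) y -
     'D_e1 (F \o chart_inv a) y * 'D_e0 (G \o chart_inv a) y) *
  (form_coord X omega a 0 1 y)^-1.
have kE y : chart_cod a y -> (bracket omega F G \o chart_inv a) y = k y.
  move=> ay; rewrite /k -(bracket_chart omega sF sG Xa ay) mulfK//.
  exact: form_coord_neq0.
have ck : {for a p, continuous k}.
  exact: (cvgM (cvgN (cvgB (cvgM (cD F 0 sF) (cD G 1 sG))
    (cvgM (cD F 1 sF) (cD G 0 sG)))) (cvgV W0 cW)).
apply: near_eq_continuous ck.
by apply: filterS (near_chart_cod cap) => y ay; rewrite kE.
Qed.

(** Radius and density bound form a pair so that one use of [choice] selects both; neither involves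
    F or G. *)
Lemma chart_cube p : exists rW : R * R, [/\ 0 < rW.1, 0 < rW.2 &
  forall y, in_cube (chart_at X p p) rW.1 y -> chart_cod (chart_at X p) y /\
    `|form_coord X omega (chart_at X p) 0 1 y| <= rW.2].
Proof.
set a := chart_at X p.
have Xa : atlas X a := chart_at_atlas X p.
have ap : chart_dom a p := chart_at_dom X p.
have cap : chart_cod a (a p) by exact: chart_map_cod.
have cW : {for a p, continuous (form_coord X omega a 0 1)}.
  by apply: differentiable_continuous; exact: (form_smooth omega 0 1 Xa [::]).
pose W := `|form_coord X omega a 0 1 (a p)| + 1.
have nW : \forall y \near a p, `|form_coord X omega a 0 1 y| <= W.
  have cN : `|form_coord X omega a 0 1 y| @[y --> a p] -->
    `|form_coord X omega a 0 1 (a p)| by exact: cvg_norm cW.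
  have := cvgr_lt _ cN W; rewrite ltrDl ltr01 => /(_ _ isT).
  by apply: filterS => y /ltW.
have [e e_gt0 eP] : exists2 e : R, 0 < e & forall y, `|y - a p| < e ->
    chart_cod a y /\ `|form_coord X omega a 0 1 y| <= W.
  have : \forall y \near a p, chart_cod a y /\ `|form_coord X omega a 0 1 y| <= W.
    by apply: filterS2 (near_chart_cod cap) nW => y.
  move/nbhs_ballP => [e /= e_gt0 eP]; exists e => // y ye.
  by apply: eP; rewrite -ball_normE /= distrC.
exists (e / 2, W); split => /=; [by rewrite divr_gt0|by rewrite ltr_wpDl|].
move=> y ye; apply: eP.
have : `|y - a p| <= e / 2.
  rewrite /Num.norm /= mx_normrE; apply: bigmax_le => [|[i j] _ /=]; first by lra.
  by rewrite (ord1 i) !mxE; exact: ye.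
by move=> /le_lt_trans; apply; lra.
Qed.

(** The boxes of all cubes in a finite cover have total area at most [sigma * A] < 1, so some offset
    lies in none of them. The cover is fixed before F and G, hence so is [sigma]. *)
Lemma lattice_shift : exists2 sigma : R, 0 < sigma & forall F G : M -> R,
  smooth X F -> smooth X G -> (forall p, `|bracket omega F G p| <= sigma) ->
  exists a b : R, [/\ 0 <= a <= 1, 0 <= b <= 1 &
    forall p (k l : int), ~ (F p = a + k%:~R /\ G p = b + l%:~R)].
Proof.
have [rW rWP] := choice chart_cube.
pose U p : set M := interior [set q | chart_dom (chart_at X p) q /\
  in_cube (chart_at X p p) (rW p).1 (chart_at X p q)].
have Up p : U p p.
  have ap : chart_dom (chart_at X p) p := chart_at_dom X p.
  have [r0 _ _] := rWP p.
  have n1 : \forall q \near p, chart_dom (chart_at X p) q.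
    by apply: open_nbhs_nbhs; split=> //; exact: chart_dom_open.
  have n2 : \forall q \near p, in_cube (chart_at X p p) (rW p).1 (chart_at X p q).
    apply: (chart_map_cvg ap); apply/nbhs_ballP; exists (rW p).1 => //= y.
    rewrite -ball_normE /= => yr i; apply/ltW; apply: le_lt_trans yr.
    rewrite [leRHS]distrC [leRHS]/Num.norm /= mx_normrE.
    apply: le_trans (le_bigmax _ _ (0, i)); by rewrite /= !mxE.
  exact: filterS2 n1 n2 => q.
have [D DU] : exists D : seq M, forall q, exists2 p, p \in D & U p q.
  have [p0 _] := M_nonempty.
  pose T : ptopologicalType := HB.pack M (isPointed.Build M p0).
  have := M_compact; rewrite (_ : compact _ = @cover_compact T [set: M]); last first.
    by rewrite -compact_cover.
  move=> /(_ M setT U (fun p _ => open_interior _))[|D _ DU].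
    by move=> q _; exists q.
  by exists (finmap.enum_fset D) => q; have [p pD Upq] := DU q I; exists p.
pose A := \sum_(p <- D) 768 * (rW p).2 * (rW p).1 ^+ 2.
have A0 : 0 <= A.
  apply: sumr_ge0 => p _; have [r0 W0 _] := rWP p.
  by rewrite !mulr_ge0 ?sqr_ge0// ltW.
exists (A + 1)^-1; first by rewrite invr_gt0; lra.
set sigma := (A + 1)^-1; have sigma0 : 0 < sigma by rewrite invr_gt0; lra.
move=> F G sF sG bFG.
have boxes p : exists s : seq box,
    \sum_(B <- s) box_area B <= 768 * ((rW p).2 * sigma) * (rW p).1 ^+ 2 /\
    covers_hits (F \o chart_inv (chart_at X p)) (G \o chart_inv (chart_at X p)) s
      (chart_at X p p) (rW p).1.
  have [r0 W0 rP] := rWP p; have Xa := chart_at_atlas X p.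
  have [|||||s sA sC] := @covers_hits_square R (F \o chart_inv (chart_at X p))
    (G \o chart_inv (chart_at X p)) (chart_at X p p) (rW p).1 ((rW p).2 * sigma).
  - by rewrite mulr_gt0.
  - by [].
  - by move=> x /rP[ax _]; exact: (smooth_chart_differentiable sF Xa ax).
  - by move=> x /rP[ax _]; exact: (smooth_chart_differentiable sG Xa ax).
  - move=> x /rP[ax Wx]; rewrite -normrN -(bracket_chart omega sF sG Xa ax).
    by rewrite normrM mulrC ler_pM.
  by exists s.
have [s sP] := choice boxes.
have [|a [b [a01 b01 ab]]] := @boxes_miss R (flatten [seq s p | p <- D]).
  rewrite big_flatten big_map /=.
  apply: (@le_lt_trans _ _ (sigma * A)); last first.
    by rewrite /sigma mulrC ltr_pdivrMr ?mul1r; lra.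
  rewrite /A mulr_sumr; apply: ler_sum => p _; have [sA _] := sP p.
  by apply: le_trans sA _; rewrite le_eqVlt; apply/orP; left; apply/eqP; ring.
exists a, b; split=> // q k l [Fq Gq].
have [p pD /interior_subset[/= aq cq]] := DU q.
have [_ sC] := sP p; have qE := chart_mapK (mem_set aq).
have := sC _ _ _ k l cq a01 b01; rewrite /= qE => /(_ Fq Gq) hs.
move/negP: ab; apply; elim: D pD {DU A A0 sigma sigma0 bFG boxes sP} => // p' D IH.
rewrite inE /= has_cat => /predU1P[<-|/IH ->]; last by rewrite orbT.
by rewrite hs.
Qed.

Lemma commuting_approx : exists2 sigma : R, 0 < sigma & forall F G : M -> R,
  smooth X F -> smooth X G -> (forall p, `|bracket omega F G p| <= sigma) ->
  exists F' G', [/\ smooth X F', smooth X G',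
    forall p, bracket omega F' G' p = 0,
    forall p, `|F p - F' p| <= 2 & forall p, `|G p - G' p| <= 2].
Proof.
have [sigma sigma0 shift] := lattice_shift; exists sigma => // F G sF sG bFG.
have [a [b [/andP[a0 a1] /andP[b0 b1] off]]] := shift F G sF sG bFG.
have [cF cFP] := continuous_bounded (smooth_continuous sF).
have [cG cGP] := continuous_bounded (smooth_continuous sG).
(* The second successor leaves a margin of 1, which absorbs the offsets a and b. *)
pose N := (Num.truncn (`|cF| + `|cG|)).+2.
have Nc : `|cF| + `|cG| + 1 < N%:R by rewrite -natr1 ltrD2r truncnS_gt.
have cF0 := normr_ge0 cF; have cG0 := normr_ge0 cG.
have lF := ler_norm cF; have lG := ler_norm cG.
(* The offsets turn the missed lattice into Z^2, and N moves all values into [0, 2N], where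
   [stair (N + N)] stays close to the identity. *)
pose u p : R := F p - (a - N%:R); pose v p : R := G p - (b - N%:R).
pose stairs (f g : M -> R) p : R := stair (N + N) (f p) (width (g p)).
pose F' p : R := stairs u v p + (a - N%:R); pose G' p : R := stairs v u p + (b - N%:R).
have uv_off p (k l : int) : ~ (u p = k%:~R /\ v p = l%:~R).
  move=> [uk vl]; apply: (@off p (k - N%:Z) (l - N%:Z)).
  by rewrite !intrB -!pmulrn -uk -vl /u /v; split; ring.
have smooth_stairs (f g : M -> R) (c d e : R) : smooth X f -> smooth X g ->
    (forall p (k l : int), ~ (f p - c = k%:~R /\ g p - d = l%:~R)) ->
    smooth X (fun p => stairs (fun q => f q - c) (fun q => g q - d) p + e).
  move=> sf sg fg_off h Xh; apply: smooth_term_smooth; first exact: chart_cod_open.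
  apply: (@SmoothAdd _ _ _ (fun y => stair (N + N) (f (chart_inv h y) - c)
    (width (g (chart_inv h y) - d))) (fun=> e)); last exact: SmoothCst.
  apply: smooth_term_stair => [||x k l _]; last exact: fg_off.
    by apply: SmoothSub; [exact/SmoothBase/(sf h)|exact: SmoothCst].
  by apply: SmoothSub; [exact/SmoothBase/(sg h)|exact: SmoothCst].
have sF' : smooth X F' by exact: smooth_stairs.
have sG' : smooth X G' by apply: smooth_stairs => // p k l [vk ul]; exact: (uv_off p l k).
have cu : continuous u.
  by move=> p; apply: cvgB; [exact: (smooth_continuous sF)|exact: cvg_cst].
have cv : continuous v.
  by move=> p; apply: cvgB; [exact: (smooth_continuous sG)|exact: cvg_cst].
have near_cstD (f : M -> R) e p : near_cst f p -> near_cst (fun q => f q + e) p.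
  by move=> [c fc]; exists (c + e); apply: filterS fc => q ->.
have dist (f : M -> R) (w c : R) p : `|f p| + 1 <= N%:R -> 0 <= c <= 1 -> 0 <= w <= 1 ->
    `|f p - (stair (N + N) (f p - (c - N%:R)) w + (c - N%:R))| <= 2.
  move=> fN /andP[c0 c1] w01.
  have -> : f p - (stair (N + N) (f p - (c - N%:R)) w + (c - N%:R)) =
    - (stair (N + N) (f p - (c - N%:R)) w - (f p - (c - N%:R))) by ring.
  rewrite normrN stair_dist// natrD; have := ler_norm (f p); have := ler_norm (- f p).
  by rewrite normrN; lra.
exists F', G'; split=> // [p|p|p].
- apply: near_cst_bracket => //.
  have [far|far] := strips_disjoint (uv_off p); [left|right]; apply: near_cstD.
    exact: (near_cst_stair _ (cu p) (cv p) far).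
  exact: (near_cst_stair _ (cv p) (cu p) far).
- by apply: dist; rewrite ?a0 ?width_ge0 ?width_le1//; have := cFP p; lra.
- by apply: dist; rewrite ?b0 ?width_ge0 ?width_le1//; have := cGP p; lra.
Qed.

End compact_surface.

(** * The profile function *)

Section sup_norm.
Context {R : realType} {M : topologicalType}.
Hypothesis M_nonempty : [set: M] !=set0.
Hypothesis M_compact : compact [set: M].
Implicit Types F G : M -> R.

Lemma le_sup_norm F p : continuous F -> `|F p| <= sup_norm F.
Proof.
move=> cF; have [c cP] := continuous_bounded M_nonempty M_compact cF.
apply: ub_le_sup; last by exists p.
by exists c => _ [q _ <-].
Qed.

Lemma sup_norm_le F (c : R) : (forall p, `|F p| <= c) -> sup_norm F <= c.
Proof.
move=> Fc; apply: ge_sup; last by move=> _ [p _ <-].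
by have [p0 _] := M_nonempty; exists `|F p0|; exists p0.
Qed.

Lemma sup_norm_ge0 F : continuous F -> 0 <= sup_norm F.
Proof.
by move=> cF; have [p0 _] := M_nonempty; apply: le_trans (le_sup_norm p0 cF).
Qed.

End sup_norm.

Section profile.
Context {R : realType} {M : topologicalType}.
Variables (X : smooth_manifold R 2 M) (omega : symplectic_form X).
Hypothesis M_nonempty : [set: M] !=set0.
Hypothesis M_compact : compact [set: M].
Implicit Types F G : M -> R.

Let contB F G : smooth X F -> smooth X G -> continuous (F \- G).
Proof.
by move=> sF sG p; apply: cvgB; [exact: (smooth_continuous sF)|exact: (smooth_continuous sG)].
Qed.

(** With e = sqrt (s / sigma), the pair divided by e has bracket at most [sigma]. Its displacement 2
    becomes 2 e after scaling back, whence the constant 2 / sqrt sigma. *)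
Lemma commuting_nearby : exists2 C : R, 0 < C & forall F G (s : R),
  smooth X F -> smooth X G -> 0 < s -> sup_norm (bracket omega F G) <= s ->
  exists P, [/\ almost_commuting omega 0 P,
    forall p, `|F p - P.1 p| <= C * Num.sqrt s &
    forall p, `|G p - P.2 p| <= C * Num.sqrt s].
Proof.
have [sigma sigma0 approx] := commuting_approx omega M_nonempty M_compact.
pose r := Num.sqrt sigma^-1; have r0 : 0 < r by rewrite sqrtr_gt0 invr_gt0.
exists (2 * r); first by rewrite mulr_gt0.
move=> F G s sF sG s0 bs; pose e := r * Num.sqrt s.
have e0 : 0 < e by rewrite mulr_gt0// sqrtr_gt0.
have e2 : e ^+ 2 = s / sigma.
  by rewrite exprMn !sqr_sqrtr ?invr_ge0 ?ltW// mulrC.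
have sF' := smooth_scale e^-1 sF; have sG' := smooth_scale e^-1 sG.
have [|H [K [sH sK HK HF KG]]] := approx _ _ sF' sG'.
  move=> p; rewrite bracket_scale// normrM ger0_norm ?sqr_ge0//.
  have := le_sup_norm M_nonempty M_compact p (bracket_continuous (omega := omega) sF sG).
  move=> /le_trans/(_ bs) bp; rewrite exprVn e2 invf_div.
  by rewrite mulrAC ler_pdivrMr// ler_pM2l.
have near_scale (f h : M -> R) p : `|e^-1 * f p - h p| <= 2 ->
    `|f p - e * h p| <= 2 * r * Num.sqrt s.
  move=> fh; rewrite -mulrA -/e.
  have -> : f p - e * h p = e * (e^-1 * f p - h p) by field; rewrite gt_eqF.
  by rewrite normrM (gtr0_norm e0) mulrC ler_pM2r.
exists (fun p => e * H p, fun p => e * K p); split => /=.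
- split=> /=; [exact: smooth_scale|exact: smooth_scale|].
  apply: sup_norm_le => // p.
  by rewrite bracket_scale ?HK ?mulr0 ?normr0//; exact: smooth_scale.
- by move=> p; exact/near_scale/HF.
- by move=> p; exact/near_scale/KG.
Qed.

Lemma distance_near F G H K H' K' (c : R) :
  smooth X F -> smooth X G -> smooth X H -> smooth X K ->
  (forall p, `|H p - H' p| <= c) -> (forall p, `|K p - K' p| <= c) ->
  distance (F, G) (H', K') <= distance (F, G) (H, K) + 2 * c.
Proof.
move=> sF sG sH sK HH KK; rewrite /distance /=.
have tri (f h h' : M -> R) : smooth X f -> smooth X h ->
    (forall p, `|h p - h' p| <= c) -> sup_norm (f \- h') <= sup_norm (f \- h) + c.
  move=> sf sh hh; apply: sup_norm_le => // p.
  have -> : (f \- h') p = (f \- h) p + (h p - h' p) by rewrite /= addrA subrK.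
  apply: le_trans (ler_normD _ _) _; apply: lerD => //.
  exact: (le_sup_norm M_nonempty M_compact p (contB sf sh)).
by have := tri _ _ _ sF sH HH; have := tri _ _ _ sG sK KK; lra.
Qed.

Lemma distance_ge0 F G (s : R) P : smooth X F -> smooth X G ->
  almost_commuting omega s P -> 0 <= distance (F, G) P.
Proof.
move=> sF sG [sH sK _]; apply: addr_ge0;
  by apply: (sup_norm_ge0 M_nonempty M_compact); exact: contB.
Qed.

Lemma almost_commuting_le (s t : R) : s <= t ->
  almost_commuting omega s `<=` almost_commuting omega t.
Proof. by move=> st P [sH sK b]; split=> //; exact: le_trans st. Qed.

(** Keeps the set under the infimum nonempty for every s >= 0. *)
Lemma almost_commuting0 : almost_commuting omega 0 (fun=> 0, fun=> 0).
Proof.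
split; [exact: smooth_cst|exact: smooth_cst|].
apply: sup_norm_le => // p; rewrite near_cst_bracket ?normr0//; try exact: smooth_cst.
by left; exists 0; exact: nearW.
Qed.

Lemma profile_le F G (s : R) P : smooth X F -> smooth X G ->
  almost_commuting omega s P -> profile omega F G s <= distance (F, G) P.
Proof.
move=> sF sG sP; apply: ge_inf; last by exists P.
by exists 0 => _ [Q sQ <-]; exact: distance_ge0 sQ.
Qed.

Lemma le_profile F G (s c : R) : 0 <= s ->
  (forall P, almost_commuting omega s P -> c <= distance (F, G) P) ->
  c <= profile omega F G s.
Proof.
move=> s0 cP; apply: lb_le_inf; last by move=> _ [P sP <-]; exact: cP.
exists (distance (F, G) (fun=> 0, fun=> 0)); exists (fun=> 0, fun=> 0) => //.
exact: almost_commuting_le s0 _ almost_commuting0.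
Qed.

Lemma profile_lower_bound : exists2 C : R, 0 < C & forall F G (s : R),
  smooth X F -> smooth X G -> 0 <= s ->
  profile omega F G 0 - C * Num.sqrt s <= profile omega F G s.
Proof.
(* The factor 2 adds the displacements of the two components. *)
have [C C0 nearby] := commuting_nearby; exists (2 * C); first by rewrite mulr_gt0.
(* The case s = 0 is separate because the rescaling divides by a multiple of sqrt s. *)
move=> F G s sF sG; rewrite le_eqVlt => /predU1P[<-|s0].
  by rewrite sqrtr0 mulr0 subr0.
apply: le_profile => [|[H K] [/= sH sK HK]]; first exact: ltW.
have [[H' K'] [cHK' /= HH KK]] := nearby H K s sH sK s0 HK.
rewrite lerBlDr -mulrA; apply: le_trans (profile_le sF sG cHK') _.
exact: distance_near.
Qed.

Lemma profile_antitone F G (s : R) : smooth X F -> smooth X G -> 0 <= s ->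
  profile omega F G s <= profile omega F G 0.
Proof.
move=> sF sG s0; apply: le_profile => // P cP; apply: profile_le => //.
exact: almost_commuting_le s0 _ cP.
Qed.

End profile.

Theorem proposition1p9 (R : realType) (M : topologicalType)
    (X : smooth_manifold R 2 M) (omega : symplectic_form X)
    (M_nonempty : [set: M] !=set0)
    (M_compact : compact [set: M])
    (M_connected : connected [set: M]) :
  (exists C : R, 0 < C /\
    forall F G : M -> R, smooth X F -> smooth X G ->
    forall s : R, 0 <= s ->
      profile omega F G s >= profile omega F G 0 - C * Num.sqrt s) /\
  (forall F G : M -> R, smooth X F -> smooth X G ->
    profile omega F G s @[s --> within [set s | 0 <= s] (nbhs (0 : R))]
      --> profile omega F G 0).
Proof.
have [C C0 lower] := profile_lower_bound omega M_nonempty M_compact.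
split; first by exists C; split=> // F G sF sG s s0; exact: lower.
move=> F G sF sG.
(* The upper function is constant because the profile decreases from its value at 0. The lower one
   has a two-sided limit at 0, restricted at the end to s >= 0. *)
apply: (@squeeze_cvgr _ _ _ _ (fun s => profile omega F G 0 - C * Num.sqrt s)
  (cst (profile omega F G 0))); last exact: cvg_cst.
  rewrite near_withinE; apply/nearW => s s0.
  by rewrite lower// (profile_antitone omega M_nonempty M_compact).
have sqrt0 : Num.sqrt s @[s --> (0 : R)] --> (0 : R).
  by have := @sqrt_continuous R 0; rewrite /continuous_at sqrtr0.
have : profile omega F G 0 - C * Num.sqrt s @[s --> (0 : R)]
    --> profile omega F G 0 - C * 0.
  by apply: cvgB; [exact: cvg_cst|apply: cvgM; [exact: cvg_cst|]].
by rewrite mulr0 subr0 => lim; exact: cvg_within_filter.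
Qed.
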